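(* Let $M \in \mathbb{N}_0$ and $\beta > 0$, and let $(X_t)_{t \ge 0}$ be the construction-number Markov chain with maximum construction number $M$ and parameter $\beta$ (defined in the context), with an arbitrary initial distribution on $\{0,1,\dots,M\}$. Write $P_j^t = \mathbb{P}(X_t = j)$. Then $$\lim_{t \to \infty} P_0^t = 1,$$ and, for every $j \in \{1,\dots,M\}$, $$\lim_{t\to\infty} P_j^t = 0.$$
   Context: The construction-number Markov chain with maximum construction number $M \in \mathbb{N}_0$ and parameter $\beta > 0$ is the time-homogeneous continuous-time Markov chain on the finite state space $\{0,1,\dots,M\}$ (state $j$ represents the macrostate of all timelines in which exactly $j$ time machines are ever constructed) with the following transition rates. For $j \in \{0,\dots,M\}$ put $$\alpha_j = \beta\, \frac{j}{2(j+1)}.$$ From state $j$ the chain jumps to $j+1$ at rate $\alpha_j$ if $j+1 \le M$, and to $j-1$ at rate $\alpha_j$ if $j - 1 \ge 0$; all other transitions between distinct states have rate $0$ (in particular there is no transition from $M$ to $M+1$ and none from $0$ to $-1$). In particular $\alpha_0 = 0$, so state $0$ is absorbing. Having transition rates $q_{jk}$ ($j\neq k$) means that the transition function $p_{jk}(h)$ (the probability of being in state $k$ a time $h$ after being in state $j$) satisfies $p_{jk}(h) = q_{jk} h + o(h)$ for $k \ne j$ and $p_{jj}(h) = 1 - \sum_{k\neq j} q_{jk} h + o(h)$ as $h \downarrow 0$. *)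

(* Defs.v *)
From mathcomp Require Import all_boot all_order all_algebra.
From mathcomp Require Import all_classical all_reals all_analysis.

Set Implicit Arguments.
Unset Strict Implicit.
Unset Printing Implicit Defensive.

Import Order.TTheory GRing.Theory Num.Theory.
Import numFieldNormedType.Exports.

Local Open Scope classical_set_scope.
Local Open Scope ring_scope.

Definition cond_prob d (T : measurableType d) (R : realType)
    (P : probability T R) (A B : set T) : R :=
  fine (P (A `&` B)) / fine (P B).

(* Time is [0, +oo[, embedded in R: here and below nothing is required at
   negative times. *)
Record transition_function (R : realType) (n : nat) (p : R -> 'M[R]_n) : Prop :=
  TransitionFunction {
    tf_ge0 : forall (t : R) j k, 0 <= t -> 0 <= p t j k ;
    tf_sum1 : forall (t : R) j, 0 <= t -> \sum_k p t j k = 1 ;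
    tf_0 : p 0 = 1%:M ;
    (* Chapman-Kolmogorov *)
    tf_add : forall s t : R, 0 <= s -> 0 <= t -> p (s + t) = p s *m p t }.

(* The diagonal entries of q are irrelevant. *)
Definition has_rates (R : realType) (n : nat) (p : R -> 'M[R]_n)
    (q : 'I_n -> 'I_n -> R) : Prop :=
  (forall j k, k != j ->
     (fun h : R => p h j k) =
     (fun h : R => q j k * h) +o_ (0^'+) (fun h : R => h)) /\
  (forall j,
     (fun h : R => p h j j) =
     (fun h : R => 1 - (\sum_(k | k != j) q j k) * h)
       +o_ (0^'+) (fun h : R => h)).

(* The initial distribution, i.e. the law of X 0, is unconstrained. In the
   Markov property, [past] is a finite list of pairs (earlier time, state). *)
Record markov_process d (T : measurableType d) (R : realType)
    (P : probability T R) (n : nat) (X : R -> T -> 'I_n)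
    (p : R -> 'M[R]_n) : Prop := MarkovProcess {
  mp_measurable : forall (t : R) (A : set 'I_n), 0 <= t -> measurable (X t @^-1` A) ;
  mp_markov : forall (past : seq (R * 'I_n)) (t h : R) (j k : 'I_n),
    0 <= t -> 0 <= h -> {in past, forall u : R * 'I_n, 0 <= u.1 < t} ->
    let B := [set w | X t w = j /\ {in past, forall u, X u.1 w = u.2}] in
    P B != 0%E ->
    cond_prob P [set w | X (t + h) w = k] B = p h j k }.

Definition ctmc_with_rates d (T : measurableType d) (R : realType)
    (P : probability T R) (n : nat) (X : R -> T -> 'I_n)
    (q : 'I_n -> 'I_n -> R) : Prop :=
  exists p : R -> 'M[R]_n,
    [/\ transition_function p, has_rates p q & markov_process P X p].

Definition cn_alpha (R : realType) (beta : R) (j : nat) : R :=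
  beta * (j%:R / (2 * (j%:R + 1))).

(* The cut-offs at 0 and M are enforced by the type of k. *)
Definition cn_rate (R : realType) (beta : R) (M : nat) (j k : 'I_M.+1) : R :=
  if ((k : nat) == j.+1) || ((j : nat) == k.+1) then cn_alpha beta j else 0.

Definition construction_number_chain (R : realType) (beta : R) (M : nat)
    d (T : measurableType d) (P : probability T R) (X : R -> T -> 'I_M.+1) :
    Prop :=
  ctmc_with_rates P X (@cn_rate R beta M).

Definition state_prob d (T : measurableType d) (R : realType)
    (P : probability T R) (n : nat) (X : R -> T -> 'I_n) (j : 'I_n) (t : R) :
    \bar R :=
  P [set w | X t w = j].

(* Main.v *)
Require Import Defs.
From mathcomp Require Import all_boot all_order all_algebra.
From mathcomp Require Import all_classical all_reals all_analysis.
From mathcomp Require Import ring lra.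
Import Order.TTheory GRing.Theory Num.Theory.
Import numFieldNormedType.Exports.
Local Open Scope classical_set_scope.
Local Open Scope ring_scope.

(** State 0 has total exit rate 0, and [1 - p s 0 0] is subadditive in [s], so
    [1 - p t 0 0 <= n * (1 - p (t / n) 0 0) = o(1)]: state 0 is absorbing. The
    other rates towards 0 are positive, so from every state the chain is in 0
    after some common time [tau] with probability at least some [delta > 0].
    Hence the probability of not being in 0 is at most [(1 - delta) ^ n] from
    time [n * tau] on, uniformly in the starting state. *)

Lemma tf_chain_le {R : realType} {n : nat} {p : R -> 'M[R]_n}
    (tf : transition_function p) (s t : R) (j k l : 'I_n) :
  0 <= s -> 0 <= t -> p s j k * p t k l <= p (s + t) j l.
Proof.
move=> s0 t0; rewrite (tf_add tf) // mxE (bigD1 k) //= lerDl.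
by apply: sumr_ge0 => m _; rewrite mulr_ge0 // (tf_ge0 tf).
Qed.

Lemma tf_le_compl {R : realType} {n : nat} {p : R -> 'M[R]_n}
    (tf : transition_function p) (t : R) (j k l : 'I_n) :
  0 <= t -> l != k -> p t j l <= 1 - p t j k.
Proof.
move=> t0 lk; rewrite -(tf_sum1 tf j t0) (bigD1 k) //= (bigD1 l) //=.
rewrite [leRHS]addrC addKr lerDl.
by apply: sumr_ge0 => m _; rewrite (tf_ge0 tf).
Qed.

Lemma tf_le1 {R : realType} {n : nat} {p : R -> 'M[R]_n}
    (tf : transition_function p) (t : R) (j k : 'I_n) :
  0 <= t -> p t j k <= 1.
Proof.
move=> t0; rewrite -(tf_sum1 tf j t0) (bigD1 k) //= lerDl.
by apply: sumr_ge0 => m _; rewrite (tf_ge0 tf).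
Qed.

(** Staying in [i] at each of the [m] grid times is one way to be in [i] at the end, so return
    probabilities are supermultiplicative; then [1 - a * b <= (1 - a) + (1 - b)] for [a, b <= 1]. *)
Lemma tf_exit_subadd {R : realType} {n : nat} {p : R -> 'M[R]_n}
    (tf : transition_function p) (h : R) (i : 'I_n) (m : nat) :
  0 <= h -> 1 - p (m%:R * h) i i <= m%:R * (1 - p h i i).
Proof.
move=> h0; elim: m => [|m IH]; first by rewrite !mul0r (tf_0 tf) mxE eqxx subrr.
have mh0 : 0 <= m%:R * h by rewrite mulr_ge0.
have := tf_chain_le tf (m%:R * h) h i i i mh0 h0.
have := tf_le1 tf _ i i mh0; have := tf_le1 tf _ i i h0.
rewrite -natr1 !mulrDl !mul1r => a1 b1 le_ab.
have : 0 <= (1 - p h i i) * (1 - p (m%:R * h) i i).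
  by rewrite mulr_ge0 // subr_ge0.
lra.
Qed.

(* The [o(h)] of the rates only controls [p h] near [h = 0]; cut [t] into small
   steps. *)
Lemma tf_absorbing {R : realType} {n : nat} {p : R -> 'M[R]_n}
    {q : 'I_n -> 'I_n -> R} (tf : transition_function p) (pq : has_rates p q)
    (i : 'I_n) (qi : forall k, k != i -> q i k = 0) (t : R) :
  0 <= t -> p t i i = 1.
Proof.
rewrite le_eqVlt => /predU1P[<-|t0]; first by rewrite (tf_0 tf) mxE eqxx.
apply/eqP; rewrite eq_le (tf_le1 tf _ _ _ (ltW t0)) /= -subr_le0.
apply/ler_addgt0Pl => e e0; rewrite addr0.
(* The tolerance [e / t] is chosen so that [m] steps of length [t / m] lose at most
   [m * (e / t) * (t / m) = e]. *)
have [_ /(_ i) /eqaddoP /(_ (e / t) (divr_gt0 e0 t0))] := pq.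
move=> /nbhs_ballP[r /= r0 br].
set m := (Num.bound (t / r)).+1.
have m0 : 0 < m%:R :> R by rewrite ltr0n.
have h0 : 0 < t / m%:R by rewrite divr_gt0.
have hr : t / m%:R < r.
  rewrite ltr_pdivrMr // mulrC -ltr_pdivrMr //.
  apply: lt_trans (archi_boundP _) _; first by rewrite divr_ge0 // ltW.
  by rewrite ltr_nat.
have /br /(_ h0) : ball 0 r (t / m%:R).
  by rewrite /ball /= sub0r normrN gtr0_norm.
rewrite !fctE big1 // mul0r subr0 (gtr0_norm h0) => small.
have := tf_exit_subadd tf _ i m (ltW h0).
rewrite mulrCA divff ?gt_eqF // mulr1 => /le_trans; apply.
rewrite -ler_pdivlMl //; apply: le_trans (ler_norm _) _.
rewrite distrC; apply: le_trans small _.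
by rewrite le_eqVlt; apply/predU1P; left; field; rewrite !gt_eqF.
Qed.

(** With half the rate as tolerance in the [o(h)], [p h j k] stays above [q j k / 2 * h]. *)
Lemma rate_gt0_near {R : realType} {n : nat} {p : R -> 'M[R]_n}
    {q : 'I_n -> 'I_n -> R} (pq : has_rates p q) (j k : 'I_n) :
  k != j -> 0 < q j k -> \forall h \near 0^'+, 0 < p h j k.
Proof.
move=> kj q0; have q20 : 0 < q j k / 2 by rewrite divr_gt0.
have [/(_ j k kj) /eqaddoP /(_ _ q20) pjk _] := pq.
near=> h.
have h0 : 0 < h by near: h; exact: nbhs_right_gt.
have : `|p h j k - q j k * h| <= q j k / 2 * `|h| by near: h.
rewrite (gtr0_norm h0) ler_norml => /andP[+ _].
by have := mulr_gt0 q0 h0; lra.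
Unshelve. all: by end_near. Qed.

Section Absorption.
Context {R : realType} {n : nat} {p : R -> 'M[R]_n} {i : 'I_n}.
Hypotheses (tf : transition_function p) (pii : forall t, 0 <= t -> p t i i = 1).

Lemma absorbed_homo (j : 'I_n) (s t : R) :
  0 <= s -> s <= t -> p s j i <= p t j i.
Proof.
move=> s0 st; have ts0 : 0 <= t - s by rewrite subr_ge0.
have := tf_chain_le tf _ _ j i i s0 ts0.
by rewrite pii // mulr1 addrC subrK.
Qed.

(** Induction on [m], conditioning on the state at the first time [tau]: state [i] contributes
    nothing, and the other states carry mass at most [1 - delta], each with the inductive bound. *)
Lemma not_absorbed_geometric (tau delta : R) (m : nat) (j : 'I_n) :
    0 <= tau -> delta <= 1 -> (forall k, delta <= p tau k i) ->
  1 - p (m%:R * tau) j i <= (1 - delta) ^+ m.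
Proof.
move=> tau0 d1 pd; elim: m j => [|m IH] j.
  by rewrite mul0r expr0 gerBl (tf_ge0 tf).
rewrite -natr1 mulrDl mul1r [_ + tau]addrC (tf_add tf) ?mulr_ge0 // mxE.
rewrite -[X in X - _](tf_sum1 tf j tau0) -sumrB exprS.
under eq_bigr do rewrite -{1}[p tau j _]mulr1 -mulrBr.
rewrite (bigD1 i) //= pii ?mulr_ge0 // subrr mulr0 add0r.
apply: le_trans (_ : \sum_(k | k != i) p tau j k * (1 - delta) ^+ m <= _).
  by apply: ler_sum => k _; rewrite ler_wpM2l // (tf_ge0 tf).
rewrite -mulr_suml ler_wpM2r ?exprn_ge0 ?subr_ge0 //.
rewrite lerBrDl; apply: le_trans (lerD (pd j) (lexx _)) _.
by rewrite -(tf_sum1 tf j tau0) [in leRHS](bigD1 i).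
Qed.

Lemma absorbed_cvg (tau : R) (j : 'I_n) :
    0 <= tau -> (forall k, 0 < p tau k i) -> p t j i @[t --> +oo] --> (1 : R).
Proof.
move=> tau0 ptau.
(* Since there are finitely many states, the minimum is attained, which gives a positive [delta]
   uniform in the starting state. *)
have [k _ /= dmin] := arg_minP (fun k => p tau k i) (erefl : predT i).
set delta := p tau k i in dmin.
have d1 : delta <= 1 := tf_le1 tf _ _ _ tau0.
have d01 : `|1 - delta| < 1.
  by rewrite ger0_norm ?subr_ge0 // ltrBlDl ltrDr ptau.
apply/cvgrPdist_le => e e0.
(* A single good [m] suffices: [absorbed_homo] carries the bound from [m%:R * tau] to all later
   times. *)
have /cvgrPdist_le /(_ _ e0) /filter_ex[m] := cvg_expr d01.
rewrite sub0r normrN ger0_norm ?exprn_ge0 ?subr_ge0 // => dm.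
near=> t; have mt : m%:R * tau <= t by near: t; apply: nbhs_pinfty_ge; exact: num_real.
have mtau0 : 0 <= m%:R * tau by rewrite mulr_ge0.
rewrite ger0_norm; last by rewrite subr_ge0 (tf_le1 tf) // (le_trans mtau0).
apply: le_trans dm; apply: le_trans (not_absorbed_geometric tau delta m j tau0 d1 _).
  by rewrite lerB // absorbed_homo.
by move=> l; exact: dmin.
Unshelve. all: by end_near. Qed.

End Absorption.

(** The chain can follow the path [j, j - 1, ..., 0] in steps of length [h] and then wait in 0, so
    one time [m%:R * h] serves all [j <= m]. *)
Lemma descend_gt0 {R : realType} {M : nat} {p : R -> 'M[R]_M.+1}
    (tf : transition_function p) (h : R) (h0 : 0 <= h)
    (p00 : 0 < p h ord0 ord0)
    (pdown : forall j k : 'I_M.+1, j = k.+1 :> nat -> 0 < p h j k)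
    (m : nat) (j : 'I_M.+1) :
  (j <= m)%N -> 0 < p (m%:R * h) j ord0.
Proof.
elim: m j => [|m IH] j jm.
  have -> : j = ord0 by apply/val_inj/eqP; rewrite -leqn0.
  by rewrite mul0r (tf_0 tf) mxE eqxx.
rewrite -natr1 mulrDl mul1r [_ + h]addrC.
have step (k : 'I_M.+1) : (k <= m)%N -> 0 < p h j k -> 0 < p (h + m%:R * h) j ord0.
  move=> km pjk; apply: lt_le_trans (tf_chain_le tf _ _ j k _ h0 _).
    by rewrite mulr_gt0 // IH.
  by rewrite mulr_ge0.
have [j0|j_gt0] := posnP j.
  by apply: (step ord0) => //; have -> : j = ord0 by exact: val_inj.
have jM : (j.-1 < M.+1)%N by rewrite (leq_ltn_trans (leq_pred _)).
apply: (step (Ordinal jM)) => /=; first by rewrite -ltnS prednK.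
by apply: pdown => /=; rewrite prednK.
Qed.

Lemma total_prob {R : realType} {d : measure_display} {T : measurableType d}
    {P : probability T R} {n : nat} {Y : T -> 'I_n} {K : set T}
    (mY : forall j, measurable [set w | Y w = j]) (mK : measurable K) :
  P K = (\sum_j P (K `&` [set w | Y w = j]))%E.
Proof.
rewrite -measure_bigsetU_ord.
- congr (P _); rewrite -bigcup_seq; apply/seteqP; split => w.
    by move=> Kw; exists (Y w) => //=; exact: mem_index_enum.
  by case=> j _ [].
- by move=> j; exact: measurableI.
- apply/trivIsetP => a b _ _ ab; apply/seteqP; split => w //= -[[_ Ya] [_ Yb]].
  by move: ab; rewrite -Ya -Yb eqxx.
Qed.

(** Total probability over the state at time 0, then the Markov property at time 0 with an empty
    past. *)
Lemma state_probE {R : realType} {d : measure_display} {T : measurableType d}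
    {P : probability T R} {n : nat} {X : R -> T -> 'I_n} {p : R -> 'M[R]_n}
    (mp : markov_process P X p) (k : 'I_n) (t : R) :
  0 <= t ->
  state_prob P X k t = (\sum_j fine (P [set w | X 0 w = j]) * p t j k)%:E.
Proof.
move=> t0; pose A j := [set w | X 0 w = j]; pose K := [set w | X t w = k].
have mA j : measurable (A j) by exact: (mp_measurable mp [set j]).
have mK : measurable K by exact: (mp_measurable mp [set k]).
rewrite /state_prob (total_prob mA mK) -sumEFin; apply: eq_bigr => j _.
have fKA : P (K `&` A j) \is a fin_num.
  by apply: fin_num_measure; exact: measurableI.
rewrite -[LHS]fineK //; congr EFin.
(* The Markov property says nothing about a null starting state; there both terms vanish. *)
have [A0|A0] := eqVneq (P (A j)) 0%E.
  rewrite A0 mul0r; have -> // : P (K `&` A j) = 0%E.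
  apply/eqP; rewrite eq_le measure_ge0 andbT -A0.
  by apply: le_measure; rewrite ?inE //; exact: measurableI.
have eqB : [set w | X 0 w = j /\
    {in [::], forall u : R * 'I_n, X u.1 w = u.2}] = A j.
  by apply/seteqP; split => w //= -[].
have := @mp_markov _ _ _ _ _ _ _ mp [::] 0 t j k (lexx 0) t0.
rewrite /= eqB add0r => /(_ _ A0) <- //.
rewrite /cond_prob mulrC divfK // fine_eq0 //.
by apply: fin_num_measure.
Qed.

(** The law at time [t] averages the rows of [p t] with fixed weights of sum 1, so a limit common to
    all rows passes to it. *)
Lemma state_prob_cvg {R : realType} {d : measure_display} {T : measurableType d}
    {P : probability T R} {n : nat} {X : R -> T -> 'I_n} {p : R -> 'M[R]_n}
    (mp : markov_process P X p) (k : 'I_n) (l : R) :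
  (forall j, p t j k @[t --> +oo] --> l) ->
  state_prob P X k t @[t --> +oo] --> l%:E.
Proof.
move=> pl.
have mA j : measurable [set w | X 0 w = j] by exact: (mp_measurable mp [set j]).
have sum1 : \sum_j fine (P [set w | X 0 w = j]) = 1.
  apply: EFin_inj; rewrite -(probability_setT P) (total_prob mA) // -sumEFin.
  by apply: eq_bigr => j _; rewrite setTI fineK // fin_num_measure.
apply: (cvg_trans (G :=
  (\sum_j fine (P [set w | X 0 w = j]) * p t j k)%:E @[t --> +oo])).
  apply: near_eq_cvg; near=> t; rewrite (state_probE mp) //.
apply: cvg_EFin; first by near=> t.
rewrite -[l]mul1r -sum1 mulr_suml.
by apply: cvg_big => [|j _]; [exact: add_continuous | exact: cvgMl_tmp].
Unshelve. all: by end_near. Qed.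

Theorem mainTheorem1 (R : realType) (M : nat) (beta : R) (hbeta : 0 < beta)
    (d : measure_display) (T : measurableType d) (P : probability T R)
    (X : R -> T -> 'I_M.+1) (hX : construction_number_chain beta P X) :
  state_prob P X ord0 t @[t --> +oo] --> (1 : \bar R)%E /\
  (forall j : 'I_M.+1, (0 < j)%N ->
     state_prob P X j t @[t --> +oo] --> (0 : \bar R)%E).
Proof.
have [p [tf pq mp]] := hX.
have alpha_gt0 (j : nat) : (0 < j)%N -> 0 < cn_alpha beta j.
  move=> j0; have jR : 0 < j%:R :> R by rewrite ltr0n.
  by rewrite mulr_gt0 // divr_gt0 // mulr_gt0 // addr_gt0.
have p00 t : 0 <= t -> p t ord0 ord0 = 1.
  apply: (tf_absorbing tf pq) => k _.
  by rewrite /cn_rate /cn_alpha mul0r mulr0 if_same.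
(* There are finitely many pairs of states, so one small [h] works for all downward jumps at
   once. *)
have down_near : \forall h \near 0^'+,
    forall jk : 'I_M.+1 * 'I_M.+1, jk.1 = jk.2.+1 :> nat -> 0 < p h jk.1 jk.2.
  apply: filter_forall => -[j k] /=.
  have [jk|/eqP jk] := eqVneq (j : nat) k.+1; last by near=> h.
  have kj : k != j by rewrite -val_eqE /= jk ltn_eqF.
  have : 0 < cn_rate beta j k.
    by rewrite /cn_rate jk eqxx orbT alpha_gt0.
  by move=> /(rate_gt0_near pq j k kj); apply: filterS.
have [h [h0 down]] := filter_ex (filterI (nbhs_right_gt (0 : R)) down_near).
have p_cvg1 j : p t j ord0 @[t --> +oo] --> (1 : R).
  (* Every state is at most [M], so [M] steps of length [h] reach 0 from anywhere. *)
  apply: (absorbed_cvg tf p00 (M%:R * h)); first by rewrite mulr_ge0 // ltW.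
  move=> k; apply: (descend_gt0 tf) => //.
  - exact: ltW.
  - by rewrite p00 // ltW.
  - by move=> j' l; exact: (down (j', l)).
  - by rewrite -ltnS.
split=> [|j j0]; apply: (state_prob_cvg mp) => // k.
have j_neq0 : j != ord0 by rewrite -val_eqE /= -lt0n.
(* Row sums are 1, so a state other than 0 gets at most the mass missing from 0. *)
apply: (@squeeze_cvgr _ _ _ _ (cst 0) (fun t => 1 - p t k ord0)).
- near=> t; have t0 : 0 <= t by near: t; apply: nbhs_pinfty_ge; exact: num_real.
  by rewrite (tf_ge0 tf) // (tf_le_compl tf).
- exact: cvg_cst.
- by rewrite -[0](subrr 1); apply: cvgB => //; exact: cvg_cst.
Unshelve. all: by end_near. Qed.
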